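(* Let $G$ be a finitely generated sofic group. Then: (i) $G$ is $L^1$-surjunctive; (ii) $G$ is dual $L^1$-surjunctive; (iii) the twisted group ring $D^1(k[G])$ is stably finite for every field $k$.
   Context: Sofic group (standard notion): $G$ is sofic if for every finite $K\subset G$ and every $\varepsilon>0$ there exist $n\ge 1$ and a map $\varphi\colon G\to \mathrm{Sym}(n)$ with $d_H(\varphi(gh),\varphi(g)\varphi(h))\le\varepsilon$ for all $g,h\in K$ and $d_H(\varphi(g),\varphi(h))\ge 1-\varepsilon$ for all distinct $g,h\in K$, where $d_H$ is the normalized Hamming distance. For a set $B$, $B^G$ is the set of maps (configurations) $G\to B$, with the prodiscrete topology and the shift action $(gx)(h)=x(g^{-1}h)$. For $x\in B^G$, $\Sigma(x)=\overline{\{gx: g\in G\}}\subset B^G$. Configurations $x,y\in B^G$ are asymptotic if $x|_{G\setminus E}=y|_{G\setminus E}$ for some finite $E\subset G$. Let $V$ be a vector space over a field. For a finite subset $M\subset G$ (a memory), let $S=V^{V^M}$ be the set of all maps $V^M\to V$. For $s\in S^G$, the non-uniform cellular automaton (NUCA) $\sigma_s\colon V^G\to V^G$ is defined by $\sigma_s(x)(g)=s(g)\big((g^{-1}x)|_M\big)$. It is linear if it is a linear map (equivalently, all local maps $s(g)$ are linear). It is a cellular automaton (CA) if $s$ is constant. $\sigma_s$ is a local perturbation of $\sigma_c$ if $s$ and $c$ are asymptotic. $\mathrm{LNUCA}_c(G,V)$ is the set of linear NUCA $V^G\to V^G$ of finite memory which are local perturbations of a linear CA, that is, the maps $\sigma_s$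 with $M$ finite, all $s(g)\colon V^M\to V$ linear, and $s$ asymptotic to a constant configuration $c$ of linear maps $V^M\to V$. $\sigma_s$ is pre-injective if $\sigma_s(x)=\sigma_s(y)$ implies $x=y$ for all asymptotic $x,y\in V^G$. It is post-surjective if for all $x,y\in V^G$ with $y$ asymptotic to $\sigma_s(x)$, there is $z\in V^G$ asymptotic to $x$ with $\sigma_s(z)=y$. It is stably injective (resp. stably post-surjective) if $\sigma_p$ is injective (resp. post-surjective) for every $p\in\Sigma(s)$. $G$ is $L^1$-surjunctive (resp. dual $L^1$-surjunctive) if for every finite-dimensional vector space $V$ (over any field) and every $\tau\in\mathrm{LNUCA}_c(G,V)$ that is stably injective (resp. stably post-surjective), $\tau$ is surjective (resp. pre-injective). For a field $k$, $D^1(k[G])=k[G]\times (k[G])[G]$, where $k[G]$ is the group ring (finitely supported functions $G\to k$) and $(k[G])[G]$ is the set of finitely supported functions $G\to k[G]$. Addition is component-wise and multiplication is $(\alpha_1,\beta_1)*(\alpha_2,\beta_2)=(\alpha_1\alpha_2,\ \alpha_1\beta_2+\beta_1\alpha_2+\beta_1\beta_2)$, where $\alpha_1\alpha_2$ is the product in $k[G]$, and for $\alpha\in k[G]$, $\beta,\gamma\in (k[G])[G]$ and $g,h\in G$: $(\alpha\beta)(g)(h)=\sum_{t\in G}\alpha(t)\,\beta(gt)(t^{-1}h)$, $(\beta\alpha)(g)(h)=\sum_{t\in G}\beta(g)(t)\,\alpha(t^{-1}h)$, $(\beta\gamma)(g)(h)=\sum_{t\in G}\beta(g)(t)\,\gamma(gt)(t^{-1}h)$.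 A ring $R$ is stably finite if for every $n\ge1$, every one-sided invertible element of the matrix ring $M_n(R)$ is a two-sided unit. *)

(* Defs.v *)
(* MathComp and MathComp-Analysis.  An abstract group is a [groupType], which
   need not be finite; [{malg A[K]}] is the additive group of finitely supported
   functions K -> A, with values [f@_x] and support [msupp f]. *)
From HB Require Import structures.
From mathcomp Require Import all_boot all_order all_algebra all_fingroup.
From mathcomp Require Import finmap monalg.
From mathcomp Require Import all_classical reals topology.

Set Implicit Arguments.
Unset Strict Implicit.
Unset Printing Implicit Defensive.

Import GRing.Theory Num.Theory.
Local Open Scope ring_scope.

Section Groups.

Definition finitely_generated (G : groupType) : Prop :=
  exists A : {fset G}, forall H : {pred G},
    group_closed H -> {subset A <= H} -> forall g, g \in H.

Definition hamming (R : realType) (n : nat) (s t : 'S_n) : R :=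
  #|[pred i | s i != t i]|%:R / n%:R.

(* The product of 'S_n composes permutations from left to right.  As the
   Hamming distance is invariant under inversion, replacing phi by g |-> (phi g)^-1
   shows that the other convention gives the same notion. *)
Definition sofic (R : realType) (G : groupType) : Prop :=
  forall (K : {fset G}) (eps : R), 0 < eps ->
    exists n : nat, (0 < n)%N /\ exists phi : G -> 'S_n,
      (forall g h, g \in K -> h \in K ->
         hamming R (phi (g * h)%g) (phi g * phi h)%g <= eps) /\
      (forall g h, g \in K -> h \in K -> g != h ->
         1 - eps <= hamming R (phi g) (phi h)).

End Groups.

Section Configurations.
Variables (G : groupType) (B : Type).

Definition shift (g : G) (x : G -> B) : G -> B := fun h => x (g^-1 * h)%g.

Definition asymptotic (x y : G -> B) : Prop :=
  exists E : {fset G}, forall g, g \notin E -> x g = y g.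

End Configurations.

Definition orbit_closure (G : groupType) (B : choiceType) (x : G -> B) :
    set (G -> B) :=
  closure (range (fun g => shift g x) : set {ptws G -> discrete_topology B}).

Notation local_map V M := ({ffun M -> V} -> V).

Section NUCA.
Variables (k : fieldType) (V : lmodType k) (G : groupType).

Definition pre_injective (f : (G -> V) -> (G -> V)) : Prop :=
  forall x y, asymptotic x y -> f x = f y -> x = y.

Definition post_surjective (f : (G -> V) -> (G -> V)) : Prop :=
  forall x y, asymptotic y (f x) -> exists z, asymptotic z x /\ f z = y.

Variable M : {fset G}.

Definition restr (x : G -> V) : {ffun M -> V} := [ffun m => x (val m)].

Definition nuca (s : G -> local_map V M) (x : G -> V) : G -> V :=
  fun g => s g (restr (shift g^-1%g x)).

(* The maps [nuca s], for s satisfying [lnuca_c s], are the elements of LNUCA_c(G, V)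
   with memory M. *)
Definition lnuca_c (s : G -> local_map V M) : Prop :=
  (forall g, linear (s g)) /\
  exists c : local_map V M,
    linear c /\ asymptotic s (fun=> c).

Definition stably_injective (s : G -> local_map V M) : Prop :=
  forall p, orbit_closure s p -> injective (nuca p).

Definition stably_post_surjective (s : G -> local_map V M) : Prop :=
  forall p, orbit_closure s p -> post_surjective (nuca p).

End NUCA.

Definition L1_surjunctive (G : groupType) : Prop :=
  forall (k : fieldType) (V : vectType k) (M : {fset G}) (s : G -> local_map V M),
    lnuca_c s -> stably_injective s -> forall y, exists x, nuca s x = y.

Definition dual_L1_surjunctive (G : groupType) : Prop :=
  forall (k : fieldType) (V : vectType k) (M : {fset G}) (s : G -> local_map V M),
    lnuca_c s -> stably_post_surjective s -> pre_injective (nuca s).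

Section TwistedConvolution.
Variables (k : fieldType) (G : groupType).
Local Notation kG := {malg k[G]}.
Implicit Types (a : kG) (b c : G -> kG).

(* tconv a b = (h |-> \sum_(t in G) a(t) b(t)(t^-1 h)); the four products of the
   twisted group ring are instances of it. *)
Definition tconv a b : kG :=
  [malg h in [fset (t * u)%g | t in msupp a, u in msupp (b t)]%fset =>
     \sum_(t <- msupp a) a@_t * (b t)@_(t^-1 * h)%g].

Lemma tconvE a b h :
  (tconv a b)@_h = \sum_(t <- msupp a) a@_t * (b t)@_(t^-1 * h)%g.
Proof.
rewrite mcoeffE; case: ifPn => // hN.
rewrite big_seq big1 // => t ta; rewrite [X in _ * X]mcoeff_outdom ?mulr0 //.
apply: contraNN hN => tb; apply/imfset2P; exists t => //.
by exists (t^-1 * h)%g => //; rewrite mulgA mulgV mul1g.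
Qed.

Lemma tconvEw (D : {fset G}) a b h : {subset msupp a <= D} ->
  (tconv a b)@_h = \sum_(t <- D) a@_t * (b t)@_(t^-1 * h)%g.
Proof.
move=> aD; rewrite tconvE; apply: big_fset_incl; first exact/fsubsetP.
by move=> t _ /mcoeff_outdom ->; rewrite mul0r.
Qed.

Lemma tconvDl a1 a2 b : tconv (a1 + a2) b = tconv a1 b + tconv a2 b.
Proof.
apply/malgP => h; rewrite mcoeffD.
pose D := ((msupp (a1 + a2)) `|` (msupp a1 `|` msupp a2))%fset.
rewrite !(@tconvEw D) => [|t tD|t tD|t tD]; rewrite ?in_fsetU ?tD ?orbT //.
by rewrite -big_split; apply: eq_bigr => t _; rewrite mcoeffD mulrDl.
Qed.

Lemma tconvDr a b c : tconv a (fun t => b t + c t) = tconv a b + tconv a c.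
Proof.
apply/malgP => h; rewrite mcoeffD !tconvE -big_split.
by apply: eq_bigr => t _; rewrite mcoeffD mulrDr.
Qed.

Lemma eq_tconv a b c : b =1 c -> tconv a b = tconv a c.
Proof. by move=> /funext ->. Qed.

Lemma tconv0l b : tconv 0 b = 0.
Proof. by apply/malgP=> h; rewrite tconvE msupp0 big_seq_fset0 mcoeff0. Qed.

Lemma tconv0r a : tconv a (fun=> 0) = 0.
Proof.
by apply/malgP=> h; rewrite tconvE mcoeff0 big1 // => t _; rewrite mcoeff0 mulr0.
Qed.

Lemma tconvA a b c :
  tconv (tconv a b) c = tconv a (fun t => tconv (b t) (fun u => c (t * u)%g)).
Proof.
apply/malgP => h.
pose D := [fset (t * u)%g | t in msupp a, u in msupp (b t)]%fset.
have sD : {subset msupp (tconv a b) <= D}.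
  move=> w; apply: contraLR => wD; rewrite -mcoeff_eq0.
  by rewrite mcoeffE (negbTE wD).
rewrite (tconvEw _ _ sD) tconvE.
under eq_bigr do rewrite tconvE mulr_suml.
rewrite exchange_big /= big_seq [RHS]big_seq; apply: eq_bigr => t ta.
under eq_bigr do rewrite -mulrA.
rewrite -mulr_sumr tconvE; congr (_ * _).
pose Dt := [fset (t * u)%g | u in msupp (b t)]%fset.
transitivity (\sum_(w <- Dt) (b t)@_(t^-1 * w)%g * (c w)@_(w^-1 * h)%g).
  symmetry; apply: big_fset_incl.
    by apply/fsubsetP => w /imfsetP[u /= ub ->]; apply/imfset2P; exists t => //; exists u.
  move=> w _ wDt; rewrite mcoeff_outdom ?mul0r //.
  apply: contraNN wDt => bw; apply/imfsetP; exists (t^-1 * w)%g => //.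
  by rewrite mulgA mulgV mul1g.
rewrite big_imfset /=; last by move=> u v _ _ /mulgI.
by apply: eq_bigr => u _; rewrite mulgA mulVg mul1g invgM mulgA.
Qed.

End TwistedConvolution.

Section TwistedGroupRing.
Variables (k : fieldType) (G : groupType).
Local Notation kG := {malg k[G]}.
Local Notation kGG := {malg {malg k[G]}[G]}.
Implicit Types (a : kG) (b c : kGG).

Definition gmul a1 a2 : kG := tconv a1 (fun=> a2).

(* (a b)(g)(h) = \sum_t a(t) b(gt)(t^-1 h) vanishes unless g t is in the support
   of b for some t in the support of a. *)
Definition mulGB a b : kGG :=
  [malg g in [fset (s * t^-1)%g | s in msupp b, t in msupp a]%fset =>
     tconv a (fun t => b@_(g * t)%g)].

Definition mulBG b a : kGG := [malg g in msupp b => tconv b@_g (fun=> a)].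

Definition mulBB b c : kGG :=
  [malg g in msupp b => tconv b@_g (fun t => c@_(g * t)%g)].

Lemma mulGBE a b g : (mulGB a b)@_g = tconv a (fun t => b@_(g * t)%g).
Proof.
rewrite mcoeffE; case: ifPn => // gN.
apply/malgP => h; rewrite mcoeff0 tconvE big_seq big1 // => t ta.
rewrite [b@__]mcoeff_outdom ?mcoeff0 ?mulr0 //.
apply: contraNN gN => gb; apply/imfset2P; exists (g * t)%g => //.
by exists t => //; rewrite -mulgA mulgV mulg1.
Qed.

Lemma mulBGE b a g : (mulBG b a)@_g = tconv b@_g (fun=> a).
Proof.
rewrite mcoeffE; case: ifPn => // gN.
by rewrite mcoeff_outdom // tconv0l.
Qed.

Lemma mulBBE b c g : (mulBB b c)@_g = tconv b@_g (fun t => c@_(g * t)%g).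
Proof.
rewrite mcoeffE; case: ifPn => // gN.
by rewrite [b@__]mcoeff_outdom // tconv0l.
Qed.

Definition D1 : Type := (kG * kGG)%type.

HB.instance Definition _ := GRing.Zmodule.on D1.

Definition D1_one : D1 := (<< 1%g >>, 0).

Definition D1_mul (x y : D1) : D1 :=
  (gmul x.1 y.1, mulGB x.1 y.2 + mulBG x.2 y.1 + mulBB x.2 y.2).

Lemma D1P (x y : D1) : x.1 = y.1 -> (forall g, x.2@_g = y.2@_g) -> x = y.
Proof. by case: x y => [a b] [c d] /= -> /malgP ->. Qed.

Lemma tconv1l (b : G -> kG) : tconv << 1%g >> b = b 1%g.
Proof.
apply/malgP => h; rewrite (@tconvEw _ _ [fset 1%g]%fset) => [|t].
  by rewrite big_seq_fset1 mcoeffU eqxx mul1r invg1 mul1g.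
by move/(fsubsetP msuppU_le).
Qed.

Lemma tconv1r a : tconv a (fun=> << 1%g >>) = a.
Proof.
apply/malgP => h; rewrite (@tconvEw _ _ (h |` msupp a)%fset) => [|t ta].
  rewrite (big_fsetD1 h) ?fset1U1 //= mulVg mcoeffU eqxx mulr1 big1_fset ?addr0 //.
  move=> t; rewrite in_fsetD1 => /andP[th _] _; rewrite mcoeffU.
  case: eqP => [/esym e|_]; last by rewrite mulr0.
  by move: th; rewrite -(inj_eq (mulgI t^-1)%g) mulVg e eqxx.
by rewrite in_fsetU ta orbT.
Qed.

Lemma D1_mul2E (x y : D1) g :
  (D1_mul x y).2@_g = tconv x.1 (fun t => y.2@_(g * t)%g) +
    tconv x.2@_g (fun=> y.1) + tconv x.2@_g (fun t => y.2@_(g * t)%g).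
Proof. by rewrite /= !mcoeffD mulGBE mulBGE mulBBE. Qed.

Lemma D1_add2E (x y : D1) g : (x + y).2@_g = x.2@_g + y.2@_g.
Proof. exact: (mcoeffD g x.2 y.2). Qed.

Fact D1_mulA : associative D1_mul.
Proof.
move=> x y z; apply: D1P => [|g]; first by rewrite /= /gmul tconvA.
have yz a : tconv a (fun t => (D1_mul y z).2@_(g * t)%g) = tconv a (fun t =>
    tconv y.1 (fun u => z.2@_(g * t * u)%g) + tconv y.2@_(g * t)%g (fun=> z.1) +
    tconv y.2@_(g * t)%g (fun u => z.2@_(g * t * u)%g)).
  by apply: eq_tconv => t; rewrite D1_mul2E.
rewrite !D1_mul2E !yz /= /gmul !(tconvDl, tconvDr) !tconvA.
have assoc a (f : G -> kG) : tconv a (fun t => tconv (f t)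
    (fun u => z.2@_(g * (t * u))%g)) =
  tconv a (fun t => tconv (f t) (fun u => z.2@_(g * t * u)%g)).
  by apply: eq_tconv => t; apply: eq_tconv => u; rewrite mulgA.
rewrite !assoc -!addrA.
congr (_ + (_ + _)); rewrite [X in _ = _ + X]addrCA [RHS]addrCA.
by congr (_ + (_ + _)); rewrite addrCA.
Qed.

Fact D1_mul1l : left_id D1_one D1_mul.
Proof.
move=> x; apply: D1P => [|g]; first by rewrite /= /gmul tconv1l.
by rewrite D1_mul2E /= mcoeff0 !tconv0l !addr0 tconv1l mulg1.
Qed.

Fact D1_mul1r : right_id D1_one D1_mul.
Proof.
move=> x; apply: D1P => [|g]; first by rewrite /= /gmul tconv1r.
rewrite D1_mul2E /= tconv1r.
have z a : tconv a (fun t => (0 : kGG)@_(g * t)%g) = 0.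
  by rewrite -[RHS](tconv0r a); apply: eq_tconv => t; rewrite mcoeff0.
by rewrite !z add0r addr0.
Qed.

Fact D1_mulDl : left_distributive D1_mul +%R.
Proof.
move=> x y z; apply: D1P => [|g]; first by rewrite /= /gmul tconvDl.
rewrite D1_add2E !D1_mul2E D1_add2E [(x + y).1]/(x.1 + y.1) !tconvDl.
by rewrite [X in X + _]addrACA [LHS]addrACA.
Qed.

Fact D1_mulDr : right_distributive D1_mul +%R.
Proof.
move=> x y z; apply: D1P => [|g]; first by rewrite /= /gmul tconvDr.
have yz a : tconv a (fun t => (y + z).2@_(g * t)%g) =
    tconv a (fun t => y.2@_(g * t)%g) + tconv a (fun t => z.2@_(g * t)%g).
  by rewrite -tconvDr; apply: eq_tconv => t; rewrite D1_add2E.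
rewrite D1_add2E !D1_mul2E !yz [(y + z).1]/(y.1 + z.1) tconvDr.
by rewrite [X in X + _]addrACA [LHS]addrACA.
Qed.

Fact D1_one_neq0 : D1_one != 0.
Proof.
apply/eqP => /(congr1 fst) /(congr1 (mcoeff 1%g)) /eqP.
by rewrite /= mcoeffU eqxx mcoeff0 oner_eq0.
Qed.

HB.instance Definition _ := GRing.Zmodule_isNzRing.Build D1
  D1_mulA D1_mul1l D1_mul1r D1_mulDl D1_mulDr D1_one_neq0.

End TwistedGroupRing.

Definition stably_finite (R : nzRingType) : Prop :=
  forall (n : nat) (A : 'M[R]_n), (0 < n)%N ->
    (exists B : 'M[R]_n, A *m B = 1%:M) \/ (exists B : 'M[R]_n, B *m A = 1%:M) ->
    exists B : 'M[R]_n, A *m B = 1%:M /\ B *m A = 1%:M.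

(* Main.v *)
Require Import Defs.
From HB Require Import structures.
From mathcomp Require Import all_boot all_algebra reals.
From mathcomp Require Import all_order all_fingroup finmap monalg.
From mathcomp Require Import all_classical topology.
From mathcomp Require Import zify lra.

(** All three parts compare an operator T, given by finitely supported
coefficients, with a translation-invariant one, C, from which it differs only at
finitely many group elements: T x g = C x g for g outside a finite set E.  For a
non-uniform automaton C is the constant automaton to which it is asymptotic; for
a matrix over the twisted group ring, whose entries (alpha, beta) act as
alpha + beta(g) at the place g, it is the action of the components alpha.

The proof has two ingredients.  First, [sofic_direct_finite]: over a sofic group,
a one-sided inverse of an invariant operator, itself invariant, is two-sided.
In the finite model given by a sofic approximation on n points, A B is the
identity at all but few points, so 1 - A B has small rank.  For square matrices
1 - B A has the same rank.  But if B A is not the identity, each good point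
carries a nonzero row of 1 - B A, of bounded support, and this forces a rank
proportional to n.

Second, a Fredholm alternative: once C is bijective, T = C + e r, where r and e
factor through the finite-dimensional space V^E, and such a T is injective if
and only if it is surjective ([finite_modification_surjective],
[finite_modification_injective]).

It remains to see that C is bijective.  If G is infinite, the orbit closure of the
local maps of T contains those of C, so C is injective, respectively
post-surjective.  An injective C
has a left inverse with finitely many coefficients ([kop_left_inverse]); a
post-surjective one has a right inverse ([kop_right_inverse]), and direct
finiteness concludes.  If G is finite, then E can be taken to be G and C the
identity.  For the twisted group ring, X Y = 1 makes the invariant part of X
bijective by direct finiteness, and makes T surjective, hence injective, so that
Y is also a left inverse; both parts together detect equality in the ring, even
when G is finite and the action T alone is not faithful. *)

Set Implicit Arguments.
Unset Strict Implicit.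
Unset Printing Implicit Defensive.

Import Order.TTheory GRing.Theory Num.Theory.
Local Open Scope ring_scope.

(** * Linear algebra in infinite dimension *)

(** By Zorn's lemma there is a subspace A that is maximal among those containing U
but not w.  Maximality makes A a hyperplane complementary to the line of w, and f
is the projection onto that line. *)
Lemma linear_functional_separation (k : fieldType) (X : lmodType k)
    (U : set X) (w : X) :
  U 0 -> (forall a x y, U x -> U y -> U (a *: x + y)) -> ~ U w ->
  exists f : X -> k, [/\ scalar f, forall u, U u -> f u = 0 & f w = 1].
Proof.
move=> U0 Ulin Uw.
(* Closure under translation by U replaces the inclusion of U in A, so that the
   empty set, which is the union of the empty chain, satisfies P. *)
pose P (A : set X) := [/\ forall a x y, A x -> A y -> A (a *: x + y),
  forall u x, U u -> A x -> A (x + u) & ~ A w].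
have [F FP Ftot|A [[Alin AU Aw] Amax]] := @Zorn_bigcup X P.
  split=> [a x y [A FA Ax] [B FB By]|u x Uu [A FA Ax]|[A FA]].
  - have [AB|BA] := Ftot A B FA FB.
      by exists B => //; case: (FP B FB) => Blin _ _; apply: Blin => //; apply: AB.
    by exists A => //; case: (FP A FA) => Alin _ _; apply: Alin => //; apply: BA.
  - by exists A => //; case: (FP A FA) => _ AU _; apply: AU.
  - by case: (FP A FA).
have A0 : A 0.
  apply: contrapT => nA0.
  have Ae x : ~ A x.
    by move=> Ax; apply: nA0; rewrite -(addNr x) -scaleN1r; apply: Alin.
  have AU' : (A `<` U)%classic.
    by split=> [x /Ae//|/(_ 0 U0)].
  apply: (Amax U AU'); split=> // u x Uu Ux.
  by rewrite addrC -[u]scale1r; apply: Ulin.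
have AZ a x : A x -> A (a *: x) by move=> Ax; rewrite -[_ *: _]addr0; apply: Alin.
have UA u : U u -> A u by move=> Uu; rewrite -[u]add0r; apply: AU.
have hyper v : exists a, A (v - a *: w).
  have [Av|nAv] := pselect (A v); first by exists 0; rewrite scale0r subr0.
  pose A' : set X := fun x => exists b, A (x - b *: v).
  have AA' : (A `<` A')%classic.
    split=> [x Ax|sub]; first by exists 0; rewrite scale0r subr0.
    by apply/nAv/sub; exists 1; rewrite scale1r subrr.
  have [b Ab] : A' w.
    apply: contrapT => nA'w; apply: (Amax A' AA'); split=> //.
      move=> a x y [b Ax] [c Ay]; exists (a * b + c).
      rewrite scalerDl -scalerA opprD addrACA -scalerBr; exact: Alin.
    move=> u x Uu [b Ax]; exists b.
    by rewrite addrAC; apply: AU.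
  have b0 : b != 0.
    by apply/eqP => b0; apply: Aw; move: Ab; rewrite b0 scale0r subr0.
  exists b^-1; have := AZ (- b^-1) _ Ab.
  by rewrite scalerBr scalerA mulNr mulVf // scaleN1r opprK scaleNr addrC.
have uniq v a b : A (v - a *: w) -> A (v - b *: w) -> a = b.
  move=> Aa Ab; apply/eqP; rewrite -subr_eq0; apply: contrapT => /negP ab0.
  apply: Aw; have := AZ (a - b)^-1 _ (Alin (-1) _ _ Aa Ab).
  rewrite scaleN1r opprB addrA subrK -scalerBl scalerA mulVf ?scale1r //.
pose f v := projT1 (cid (hyper v)).
have fP v : A (v - f v *: w) by rewrite /f; case: cid.
exists f; split=> [a x y|u /UA Au|].
- apply: (uniq (a *: x + y)) => //.
  rewrite scalerDl -scalerA opprD addrACA -scalerBr; exact: Alin.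
- by apply: (uniq u) => //; rewrite scale0r subr0.
- by apply: (uniq w) => //; rewrite scale1r subrr.
Qed.

(** * Fredholm alternative for finite-rank perturbations *)

Section FredholmAlternative.
Variables (k : fieldType) (X : lmodType k) (Y : vectType k).
Variables (C : {linear X -> X}) (B : X -> X).
Variables (r : {linear X -> Y}) (e : {linear Y -> X}).
Hypotheses (CK : cancel C B) (BK : cancel B C).

Let T x := C x + e (r x).

Let B_linear : linear B.
Proof. by move=> a x y; apply: (can_inj CK); rewrite linearP !BK. Qed.

Let B' := HB.pack_for {linear X -> X} B
  (GRing.isLinear.Build _ _ _ _ B B_linear).
Let CK' : cancel C B' := CK.
Let B'K : cancel B' C := BK.

(** T is C followed by 1 + e r B, and 1 + (e) (r B) has the same kernel and cokernel,
up to isomorphism, as 1 + (r B) (e), which acts on the finite-dimensional space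
Y. *)
Let F : 'End(Y) := (\1 + linfun (r \o B' \o e))%VF.

Let FE u : F u = u + r (B' (e u)).
Proof. by rewrite add_lfunE id_lfunE lfunE. Qed.

Lemma fredholm_surjective : injective T -> forall y, exists x, T x = y.
Proof.
move=> Tinj.
have ker0 : lker F == 0%VS.
  apply/lker0P => u v; rewrite !FE => uv.
  have /Tinj /(can_inj B'K) euv : T (B' (e u)) = T (B' (e v)).
    by rewrite /T !B'K -!linearD uv.
  by move: uv; rewrite euv => /addIr.
move=> y; have /memv_imgP[v _ vE] : r (B' y) \in limg F.
  by rewrite lker0_limgf // memvf.
exists (B' y - B' (e v)); rewrite /T !linearB !B'K /= vE FE linearD /=.
by rewrite addrK subrK.
Qed.

(** Only the vectors e u need be attained: this makes the result applicable to
automata that are known to be surjective merely onto finite configurations. *)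
Lemma fredholm_injective :
  (forall u, exists x, T x = e u) -> forall x, T x = 0 -> x = 0.
Proof.
move=> Tsurj.
have F_onto : limg F = fullv.
  apply/eqP; rewrite eqEsubv subvf /=; apply/subvP => u _.
  have [w Tw] := Tsurj u; apply/memv_imgP; exists (u - r w); first exact: memvf.
  by rewrite FE linearB -Tw /T addrK CK' subrK.
have ker0 : lker F == 0%VS.
  rewrite -dimv_eq0; have := limg_ker_dim F fullv.
  by rewrite F_onto capfv -{2}[\dim fullv]add0n => /addIn ->.
move=> x Tx0.
have xE : x = - B' (e (r x)).
  by apply: (can_inj CK'); rewrite linearN B'K; apply/eqP; rewrite -addr_eq0; apply/eqP.
have rx0 : r x = 0.
  by apply: (lker0P ker0); rewrite linear0 FE {1}xE linearN addNr.
by rewrite xE rx0 !linear0.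
Qed.

End FredholmAlternative.

Section FiniteModification.
Variables (k : fieldType) (V : vectType k) (G : choiceType) (E : {fset G}).
Variables (T C : {linear (G -> V) -> (G -> V)}) (B : (G -> V) -> (G -> V)).
Hypotheses (CK : cancel C B) (BK : cancel B C).
Hypothesis TC : forall x g, g \notin E -> T x g = C x g.

Let r x : {ffun E -> V} := [ffun g => T x (val g) - C x (val g)].
Let e (u : {ffun E -> V}) : G -> V := fun g => oapp u 0 (insub g).

Let r_linear : linear r.
Proof.
move=> a x y; apply/ffunP => g; rewrite !ffunE (linearP T) (linearP C) !fctE.
by rewrite scalerBr opprD addrACA.
Qed.

Let r' := HB.pack_for {linear (G -> V) -> {ffun E -> V}} r
  (GRing.isLinear.Build _ _ _ _ r r_linear).

Let e_linear : linear e.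
Proof.
move=> a u v; apply/funext => g; rewrite /e !fctE; case: insub => [h|] /=.
  by rewrite !ffunE.
by rewrite scaler0 addr0.
Qed.

Let e' := HB.pack_for {linear {ffun E -> V} -> (G -> V)} e
  (GRing.isLinear.Build _ _ _ _ e e_linear).

Let TE x : T x = C x + e' (r' x).
Proof.
apply/funext => g; rewrite fctE /= /e; case: insubP => [h _ <-|gE] /=.
  by rewrite ffunE addrC subrK.
by rewrite addr0 TC.
Qed.

Lemma finite_modification_surjective : injective T -> forall y, exists x, T x = y.
Proof.
move=> Tinj y.
have [x y'|x <-] := fredholm_surjective (r := r') (e := e') CK BK _ y; last by exists x.
by rewrite -!TE => /Tinj.
Qed.

Lemma finite_modification_injective :
  (forall y, (forall g, g \notin E -> y g = 0) -> exists x, T x = y) ->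
  injective T.
Proof.
move=> Tsurj; apply: raddf_inj => x Tx0.
apply: (fredholm_injective (r := r') (e := e') CK BK) => [u|]; last by rewrite -TE.
have [|z zE] := Tsurj (e u); last by exists z; rewrite -TE.
by move=> g gE; rewrite /e insubN.
Qed.

End FiniteModification.

(** * Ranks of sparse matrices *)

Lemma card_bigcup_le (I T : finType) (B : I -> {set T}) :
  (#|\bigcup_i B i| <= \sum_i #|B i|)%N.
Proof.
elim/big_rec2: _ => [|i a A _ Aa]; first by rewrite cards0.
by rewrite cardsU (leq_trans (leq_subr _ _)) // leq_add2l.
Qed.

Section Rank.
Variable F : fieldType.

(** Right multiplication by A maps the row kernel of 1 - A B injectively into that
of 1 - B A, with B as inverse on it. *)
Lemma rank_1B_mulC n (A B : 'M[F]_n) :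
  (\rank (1%:M - B *m A)%R <= \rank (1%:M - A *m B)%R)%N.
Proof.
have ker : (\rank (kermx (1%:M - A *m B)%R) <= \rank (kermx (1%:M - B *m A)%R))%N.
  set K := kermx (1%:M - A *m B)%R.
  have KAB : K *m A *m B = K.
    have : K *m (1%:M - A *m B) = 0 by apply/sub_kermxP.
    by rewrite mulmxBr mulmx1 mulmxA => /eqP; rewrite subr_eq0 => /eqP.
  rewrite -{1}KAB (leq_trans (mxrankM_maxl _ _)) // mxrankS //.
  by apply/sub_kermxP; rewrite mulmxBr mulmx1 mulmxA KAB subrr.
move: ker; rewrite !mxrank_ker.
have := rank_leq_row (1%:M - A *m B)%R; have := rank_leq_row (1%:M - B *m A)%R.
lia.
Qed.

Lemma rank_le_support m n (X : 'M[F]_(m, n)) (S : {set 'I_n}) :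
  (forall i j, j \notin S -> X i j = 0) -> (\rank X <= #|S|)%N.
Proof.
move=> XS.
suff -> : X = (\matrix_(i < m, s < #|S|) X i (enum_val s)) *m
    (\matrix_(s < #|S|, j < n) (enum_val s == j)%:R).
  by apply: leq_trans (mxrankM_maxl _ _) (rank_leq_col _).
apply/matrixP => i j; rewrite !mxE.
have [jS|jS] := boolP (j \in S).
  rewrite (bigD1 (enum_rank_in jS j)) //= !mxE enum_rankK_in // eqxx mulr1.
  rewrite big1 ?addr0 // => s sj; rewrite !mxE; case: eqP => [sE|_]; last by rewrite mulr0.
  by case/eqP: sj; apply: enum_val_inj; rewrite enum_rankK_in.
rewrite XS // big1 // => s _; rewrite !mxE; case: eqP => [sE|_]; last by rewrite mulr0.
by rewrite -sE enum_valP in jS.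
Qed.

(** Every row is a combination of [\rank X] suitably chosen rows, so every nonzero
column meets the support of one of these. *)
Lemma card_support_le_rank m n (X : 'M[F]_(m, n)) kappa :
  (forall i, #|[set j | X i j != 0%R]| <= kappa)%N ->
  (#|[set j | [exists i, X i j != 0%R]]| <= \rank X * kappa)%N.
Proof.
move=> Xk; set f := maxrankfun X.
have sub : [set j | [exists i, X i j != 0%R]] \subset
    \bigcup_s [set j | X (f s) j != 0%R].
  apply/fintype.subsetP => j; rewrite inE => /existsP[i Xij].
  apply: contraT => /bigcupP jN.
  have /submxP[D XE] : (X <= rowsub f X)%MS by rewrite eq_maxrowsub.
  case/eqP: Xij; rewrite XE mxE big1 // => s _; rewrite !mxE.
  have [->|fsj] := eqVneq (X (f s) j) 0; first by rewrite mulr0.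
  by case: jN; exists s => //; rewrite inE.
apply: leq_trans (subset_leq_card sub) _.
apply: leq_trans (card_bigcup_le _) _.
rewrite -[X in (_ <= X * _)%N]card_ord -sum_nat_const.
by apply: leq_sum => s _.
Qed.

End Rank.

(** * Direct finiteness over sofic groups *)

(** Soficity with the error counted in points instead of frequencies: at the points
of Q the maps phi form an exact free partial action of K, and the remaining
points are at most a fraction 1 / m of all. *)
Lemma sofic_good_points (R : realType) (G : groupType) (K : {fset G}) (m : nat) :
  sofic R G -> exists (n : nat) (phi : G -> 'S_n) (Q : {set 'I_n}),
  [/\ (0 < n)%N, (m * #|~: Q| <= n)%N,
      forall v g h, v \in Q -> g \in K -> h \in K ->
        phi (g * h)%g v = phi h (phi g v) &
      forall v g h, v \in Q -> g \in K -> h \in K -> g != h ->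
        phi g v != phi h v].
Proof.
move=> sof; pose c := (m * #|{: K * K}|)%N.
(* Each of the pairs in K * K excludes at most 2 eps n points, so eps is chosen
   to make 2 eps m |K|^2 smaller than 1. *)
pose eps : R := (2 * c%:R + 1)^-1.
have c0 : 0 <= c%:R :> R by rewrite ler0n.
have eps0 : 0 < eps by rewrite invr_gt0; lra.
have [n [n0 [phi [phiM phiI]]]] := sof K eps eps0.
have n0R : 0 < n%:R :> R by rewrite ltr0n.
pose bad (p : K * K) := [set v |
  (phi (val p.1 * val p.2)%g v != (phi (val p.1) * phi (val p.2))%g v) ||
  ((val p.1 != val p.2) && (phi (val p.1) v == phi (val p.2) v))].
have badle p : #|bad p|%:R <= 2 * eps * n%:R :> R.
  case: p => g h; rewrite /bad /=.
  set S1 := [set v | phi (val g * val h)%g v != (phi (val g) * phi (val h))%g v].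
  set S2 := [set v | (val g != val h) && (phi (val g) v == phi (val h) v)].
  have S1le : #|S1|%:R <= eps * n%:R :> R.
    have := phiM _ _ (valP g) (valP h).
    by rewrite /hamming ler_pdivrMr // cardsE.
  have S2le : #|S2|%:R <= eps * n%:R :> R.
    have [gh|gh] := eqVneq (val g) (val h).
      rewrite (_ : S2 = finset.set0) ?cards0; first exact: mulr_ge0 (ltW _) (ltW _).
      by apply/finset.setP => v; rewrite !inE gh eqxx.
    have := phiI _ _ (valP g) (valP h) gh.
    rewrite /hamming ler_pdivlMr // mulrBl mul1r => dist.
    have := cardC [pred v | phi (val g) v != phi (val h) v].
    rewrite card_ord => /(congr1 (fun i => i%:R : R)); rewrite natrD.
    have -> : #|[predC [pred v | phi (val g) v != phi (val h) v]]| = #|S2|.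
      by rewrite cardsE; apply: eq_card => v; rewrite !inE negbK gh.
    move: dist; lra.
  have : (#|S1 :|: S2| <= #|S1| + #|S2|)%N by rewrite cardsU leq_subr.
  rewrite -(ler_nat R) natrD => le12.
  have -> : [set v | (phi (val g * val h)%g v != (phi (val g) * phi (val h))%g v)
      || (val g != val h) && (phi (val g) v == phi (val h) v)] = S1 :|: S2.
    by apply/finset.setP => v; rewrite !inE.
  lra.
pose Q := ~: \bigcup_p bad p.
have good v g h (vQ : v \in Q) (gK : g \in K) (hK : h \in K) :
    v \notin bad ([` gK]%fset, [` hK]%fset).
  by move: vQ; rewrite inE; apply: contraNN => vb; apply/bigcupP; eexists; eauto.
exists n, phi, Q; split=> //.
- rewrite -(ler_nat R) natrM finset.setCK.
  apply: (@le_trans _ _ (m%:R * \sum_p 2 * eps * n%:R)).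
    apply: ler_wpM2l => //; apply: (@le_trans _ _ (\sum_p #|bad p|)%:R).
      by rewrite ler_nat card_bigcup_le.
    by rewrite natr_sum; apply: ler_sum => p _.
  rewrite sumr_const -[X in m%:R * X]mulr_natl mulrA -natrM -/c mulrA.
  rewrite -[leRHS]mul1r ler_wpM2r ?(ltW n0R) // mulrA /eps ler_pdivrMr; lra.
- move=> v g h vQ gK hK; have := good v g h vQ gK hK.
  by rewrite inE negb_or /= negbK => /andP[/eqP -> _]; rewrite permM.
- move=> v g h vQ gK hK gh; have := good v g h vQ gK hK.
  by rewrite inE negb_or /= gh => /andP[].
Qed.

Section KernelOperators.
Variables (k : fieldType) (G : groupType) (d : nat).
Local Notation config := (G -> 'cV[k]_d).
Implicit Types (D : {fset G}) (a b : G -> G -> 'M[k]_d) (x : config).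

Definition kop D a x : config := fun g => \sum_(t <- D) a g t *m x (g * t)%g.

Fact kop_linear D a : linear (kop D a).
Proof.
move=> c x y; apply/funext => g; rewrite /kop !fctE scaler_sumr -big_split.
by apply: eq_bigr => t _; rewrite mulmxDr scalemxAr.
Qed.

HB.instance Definition _ D a :=
  GRing.isLinear.Build _ _ _ _ (kop D a) (kop_linear D a).

Lemma kop_translate D (al : G -> 'M[k]_d) x g h :
  kop D (fun=> al) x (g * h)%g = kop D (fun=> al) (fun u => x (g * u)%g) h.
Proof. by apply: eq_bigr => t _; rewrite mulgA. Qed.

(** The coefficients of a composite are the twisted convolution of those of its
factors. *)
Lemma kop_comp D D' (K : {fset G}) a b x g :
  (forall t u, t \in D -> u \in D' -> (t * u)%g \in K) ->
  kop D a (kop D' b x) g =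
  \sum_(h <- K) (\sum_(t <- D) \sum_(u <- D' | (t * u)%g == h)
      a g t *m b (g * t)%g u) *m x (g * h)%g.
Proof.
move=> DK; rewrite /kop.
under [RHS]eq_bigr do rewrite mulmx_suml.
rewrite [RHS]exchange_big /= big_seq [RHS]big_seq; apply: eq_bigr => t tD.
under [RHS]eq_bigr do rewrite mulmx_suml big_mkcond.
rewrite [RHS]exchange_big /= mulmx_sumr big_seq [RHS]big_seq.
apply: eq_bigr => u uD; rewrite (big_fsetD1 (t * u)%g) ?DK //= eqxx.
rewrite big1_fset ?addr0; first by rewrite !mulgA mulmxA.
by move=> h; rewrite !inE eq_sym => /andP[/negbTE ->].
Qed.

End KernelOperators.

Section PermutationOperators.
Variables (k : fieldType) (G : groupType) (d n : nat) (phi : G -> 'S_n).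
Implicit Types (D : {fset G}) (al : G -> 'M[k]_d) (y : 'M[k]_(d, n)).

(** The finite model of the invariant operator with coefficients al: the
configurations on n points are the columns of y, and t moves the point v to
[phi t v]. *)
Definition perm_op D al y : 'M[k]_(d, n) :=
  \sum_(t <- D) al t *m col_perm (phi t) y.

Fact perm_op_linear D al : linear (perm_op D al).
Proof.
move=> c y z; rewrite /perm_op scaler_sumr -big_split; apply: eq_bigr => t _.
by rewrite linearP /= mulmxDr scalemxAr.
Qed.

HB.instance Definition _ D al :=
  GRing.isLinear.Build _ _ _ _ (perm_op D al) (perm_op_linear D al).

Lemma col_perm_op D al y v :
  col v (perm_op D al y) = \sum_(t <- D) al t *m col (phi t v) y.
Proof.
rewrite linear_sum; apply: eq_bigr => t _.
by apply/colP => i; rewrite !mxE; apply: eq_bigr => j _; rewrite !mxE.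
Qed.

(** At a point v where phi is multiplicative, the composite in the finite model is
the composite on G evaluated at the pullback of y along the orbit map of v. *)
Lemma col_perm_op_comp D D' al be y v :
  (forall t u, t \in D -> u \in D' -> phi (t * u)%g v = phi u (phi t v)) ->
  col v (perm_op D al (perm_op D' be y)) =
  kop D (fun=> al) (kop D' (fun=> be) (fun g => col (phi g v) y)) 1%g.
Proof.
move=> phiM; rewrite col_perm_op big_seq [RHS]big_seq; apply: eq_bigr => t tD.
rewrite col_perm_op; congr (_ *m _); rewrite big_seq [RHS]big_seq.
by apply: eq_bigr => u uD'; rewrite mul1g phiM.
Qed.

End PermutationOperators.

(** For group rings this is the theorem of Elek and Szabo that group rings of sofic
groups are stably finite. *)
Theorem sofic_direct_finite (R : realType) (G : groupType) (k : fieldType)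
    (d : nat) (Da Db : {fset G}) (al be : G -> 'M[k]_d) :
  sofic R G -> cancel (kop Db (fun=> be)) (kop Da (fun=> al)) ->
  cancel (kop Da (fun=> al)) (kop Db (fun=> be)).
Proof.
move=> sof abK; pose A := kop Da (fun=> al); pose B := kop Db (fun=> be).
pose K := (1%g |` [fset (t * u)%g | t in Db, u in Da])%fset.
have K1 : 1%g \in K by rewrite fset1U1.
have DK t u : t \in Db -> u \in Da -> (t * u)%g \in K.
  move=> tD uD; rewrite in_fsetU; apply/orP; right.
  by apply/imfset2P; exists t => //; exists u.
(* The coefficients of B A - 1, to be proved zero. *)
pose zeta h : 'M[k]_d :=
  \sum_(t <- Db) \sum_(u <- Da | (t * u)%g == h) be t *m al u - (h == 1%g)%:R *: 1%:M.
have BAE x : B (A x) 1%g - x 1%g = \sum_(h <- K) zeta h *m x h.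
  under [RHS]eq_bigr do rewrite mulmxBl.
  rewrite sumrB [X in X - _](kop_comp _ _ _ _ DK); congr (_ - _).
    by apply: eq_bigr => h _; rewrite mul1g.
  rewrite (big_fsetD1 1%g) //= eqxx scale1r mul1mx big1_fset ?addr0 // => h.
  by rewrite !inE => /andP[/negbTE ->] _ _; rewrite scale0r mul0mx.
have [zeta0 x|] := pselect (forall h, h \in K -> zeta h = 0).
  apply/funext => g; apply/eqP; rewrite -subr_eq0 -[g]mulg1; apply/eqP.
  transitivity (B (A (fun u => x (g * u)%g)) 1%g - x (g * 1)%g).
    congr (_ - _); rewrite /B kop_translate; congr kop.
    by apply/funext => u; rewrite kop_translate.
  by rewrite BAE big_seq big1 // => h hK; rewrite zeta0 ?mul0mx.
move=> /existsNP[h0 /not_implyP[h0K zeta_h0]].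
have [i0 [j0 z0]] : exists i j, zeta h0 i j != 0.
  apply: contrapT => N; apply: zeta_h0; apply/matrixP => i j; rewrite [RHS]mxE.
  by apply: contrapT => /eqP zN; apply: N; exists i, j.
(* If q' points are bad, the rank estimates below give n - q' <= d |K| q', which
   contradicts (d |K| + 2) q' <= n as n > 0. *)
pose K0 := (Da `|` Db `|` K)%fset.
have [n [phi [Q [n0 Qbig phiM phiI]]]] :=
  sofic_good_points K0 (d * #|` K| + 2) sof.
have sDa : {subset Da <= K0} by move=> t tD; rewrite !in_fsetU tD.
have sDb : {subset Db <= K0} by move=> t tD; rewrite !in_fsetU tD orbT.
have sK : {subset K <= K0} by move=> t tK; rewrite in_fsetU tK orbT.
pose FA := perm_op phi Da al; pose FB := perm_op phi Db be.
pose LA := lin_mx FA; pose LB := lin_mx FB.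
have phi1 v : v \in Q -> phi 1%g v = v.
  move=> vQ; apply: (@perm_inj _ (phi 1%g)); rewrite -(phiM v 1%g 1%g) ?mulg1 //;
  exact: sK.
(* The image of 1 - A B lives on the bad points. *)
have rankAB : (\rank (1%:M - LB *m LA)%R <= d * #|~: Q|)%N.
  pose S : {set 'I_(d * n)} :=
    [set uncurry (@mxvec_index d n) p | p in [set p | p.2 \in ~: Q]].
  have cS : (#|S| <= d * #|~: Q|)%N.
    apply: leq_trans (leq_imset_card _ _) _.
    rewrite -[d in (d * _)%N]card_ord -cardsT -cardsX.
    by apply/subset_leq_card/fintype.subsetP => -[i v]; rewrite !inE.
  apply: leq_trans (rank_le_support _) cS => p q qS.
  suff : row p (1%:M - LB *m LA) 0 q = 0 by rewrite mxE.
  rewrite rowE; set y := vec_mx (delta_mx 0 p) : 'M[k]_(d, n).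
  rewrite -[delta_mx 0 p]vec_mxK -/y mulmxBr mulmx1 mulmxA !mul_vec_lin.
  case/mxvec_indexP: q qS => i v ivS.
  have vQ : v \in Q.
    by apply: contraNT ivS => vQ; apply/imsetP; exists (i, v); rewrite ?inE.
  rewrite -linearB mxvecE; suff : col v (y - FA (FB y)) = 0.
    by move/colP/(_ i); rewrite !mxE.
  rewrite linearB /= col_perm_op_comp; last first.
    by move=> t u tD uD; apply: phiM => //; [apply: sDa|apply: sDb].
  by rewrite abK phi1 // subrr.
(* The good rows of the block of 1 - B A with rows in the coordinate i0 and columns
   in the coordinate j0; this block sees the nonzero coefficient of zeta at h0. *)
pose W : 'M[k]_n := \matrix_(v, v')
  if v \in Q then (delta_mx j0 v' - FB (FA (delta_mx j0 v'))) i0 v else 0.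
have WE v v' : v \in Q -> W v v' =
    - (\sum_(h <- K) zeta h *m col (phi h v) (delta_mx j0 v')) i0 0.
  move=> vQ; rewrite -BAE mxE vQ.
  rewrite phi1 // /A /B -col_perm_op_comp; last first.
    by move=> t u tD uD; apply: phiM => //; [apply: sDb|apply: sDa].
  by rewrite !mxE opprB.
have rankW : (\rank W <= d * #|~: Q|)%N.
  apply: leq_trans (leq_trans (rank_1B_mulC LB LA) rankAB).
  pose P : 'M[k]_(n, d * n) := \matrix_v' mxvec (delta_mx j0 v').
  pose T : 'M[k]_(d * n, n) :=
    \matrix_(q, v) ((v \in Q) && (q == mxvec_index i0 v))%:R.
  suff -> : W = (P *m (1%:M - LA *m LB) *m T)^T.
    by rewrite mxrank_tr (leq_trans (mxrankM_maxl _ _)) ?mxrankM_maxr.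
  apply/matrixP => v v'; rewrite [LHS]mxE [RHS]mxE [RHS]mxE.
  case: ifP => vQ; last by rewrite big1 // => q _; rewrite [T _ _]mxE vQ mulr0.
  rewrite (bigD1 (mxvec_index i0 v)) //= [T _ _]mxE vQ eqxx mulr1.
  rewrite [X in _ = _ + X]big1 ?addr0; last first.
    by move=> q /negbTE qN; rewrite [T _ _]mxE qN andbF mulr0.
  suff -> : (P *m (1%:M - LA *m LB)) v' (mxvec_index i0 v) =
      mxvec (delta_mx j0 v' - FB (FA (delta_mx j0 v'))) 0 (mxvec_index i0 v).
    by rewrite mxvecE.
  transitivity (row v' (P *m (1%:M - LA *m LB)) 0 (mxvec_index i0 v)).
    by rewrite [RHS]mxE.
  rewrite row_mul rowK mulmxBr mulmx1 mulmxA !mul_vec_lin.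
  by rewrite linearB.
(* The row of v is supported on the orbit of v under K. *)
have supp v : (#|[set v' | W v v' != 0%R]| <= #|` K|)%N.
  rewrite cardfE; apply: leq_trans (leq_imset_card (fun h : K => phi (val h) v) predT).
  apply/subset_leq_card/fintype.subsetP => v'; rewrite inE => Wv.
  have vQ : v \in Q by apply: contraNT Wv => /negbTE vQ; rewrite mxE vQ.
  apply: contraT => v'N; case/eqP: Wv; rewrite WE // big_seq big1 ?mxE ?oppr0 // => h hK.
  rewrite (_ : col _ _ = 0) ?mulmx0 //; apply/colP => i; rewrite !mxE.
  case: (altP andP) => // -[_ /eqP hv]; case/negP: v'N; apply/imsetP.
  by exists [` hK]%fset.
(* The entry of row v at the column [phi h0 v] is the coefficient at h0 alone,
   because K acts freely at v. *)
have Qle : (#|Q| <= \rank W * #|` K|)%N.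
  apply: leq_trans (card_support_le_rank supp).
  rewrite -(card_imset Q (@perm_inj _ (phi h0))).
  apply/subset_leq_card/fintype.subsetP => _ /imsetP[v vQ ->].
  rewrite inE; apply/existsP; exists v; rewrite WE // oppr_eq0.
  rewrite (big_fsetD1 h0) //= big1_fset ?addr0; last first.
    move=> h; rewrite in_fsetD1 => /andP[hh0 hK] _.
    rewrite (_ : col _ _ = 0) ?mulmx0 //; apply/colP => i; rewrite !mxE.
    by rewrite (negbTE (phiI _ _ _ vQ (sK _ hK) (sK _ h0K) hh0)) andbF.
  rewrite mxE (bigD1 j0) //= [col _ _ _ _]mxE [delta_mx _ _ _ _]mxE !eqxx mulr1.
  rewrite big1 ?addr0 // => j jj0.
  by rewrite [col _ _ _ _]mxE [delta_mx _ _ _ _]mxE (negbTE jj0) mulr0.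
have := cardsC Q; rewrite card_ord => QC.
have QW : (#|Q| <= d * #|~: Q| * #|` K|)%N by apply: leq_trans Qle _; rewrite leq_mul2r rankW orbT.
exfalso; move: n0 Qbig QW QC; set q := #|Q|; set q' := #|~: Q|; set kap := #|` K|.
have -> : (d * q' * kap = d * kap * q')%N by rewrite mulnAC.
have [->|] := posnP q'; first by rewrite muln0; lia.
by rewrite mulnDl; set e := (d * kap * q')%N; lia.
Qed.

(** * One-sided inverses with finitely many coefficients *)

Section OneSidedInverses.
Variables (k : fieldType) (G : groupType) (d : nat).
Local Notation config := (G -> 'cV[k]_d).
Implicit Types (D : {fset G}) (x y : config).

(** Lists with repetitions are closed under concatenation, which makes them easier
to combine than coefficient functions with a prescribed finite support. *)
Lemma kop_of_seq (s : seq (G * 'M[k]_d)) :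
  exists (D : {fset G}) (be : G -> 'M[k]_d), forall x g,
    kop D (fun=> be) x g = \sum_(p <- s) p.2 *m x (g * p.1)%g.
Proof.
exists [fset p.1 | p in s]%fset, (fun t => \sum_(p <- s | p.1 == t) p.2) => x g.
rewrite /kop; under eq_bigr do rewrite mulmx_suml big_mkcond.
rewrite exchange_big /= big_seq [RHS]big_seq; apply: eq_bigr => p ps.
rewrite (big_fsetD1 p.1) /=; last by apply/imfsetP; exists p.
rewrite eqxx big1_fset ?addr0 // => h.
by rewrite !inE eq_sym => /andP[/negbTE ->].
Qed.

(** A duality argument.  If the coordinate x |-> x(1)_j is a combination of the
coordinates of A x, its coefficients form a row of the left inverse.  Otherwise
some linear functional L on functionals kills the coordinates of A x but not
this one; evaluating L at all coordinates gives a configuration, which is nonzero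
and in the kernel of A. *)
Lemma kop_left_inverse (D : {fset G}) (al : G -> 'M[k]_d) :
  (forall x, kop D (fun=> al) x = 0 -> x = 0) ->
  exists D' be, cancel (kop D (fun=> al)) (kop D' (fun=> be)).
Proof.
set A := kop D _ => Ainj.
pose U : set (config -> k^o) := fun f => exists s : seq (G * 'rV[k]_d),
  forall x, f x = (\sum_(p <- s) p.2 *m A x p.1) 0 0.
have coordU j : U (fun x => x 1%g j 0).
  apply: contrapT => NU.
  have [|a f1 f2 [s1 E1] [s2 E2]|L [Llin LU Lj]] :=
      @linear_functional_separation k (config -> k^o) U (fun x => x 1%g j 0) _ _ NU.
  - by exists [::] => x; rewrite big_nil mxE.
  - exists ([seq (p.1, a *: p.2) | p <- s1] ++ s2) => x.
    rewrite !fctE E1 E2 big_cat big_map mxE; congr (_ + _).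
    have -> : \sum_(p <- s1) a *: p.2 *m A x p.1 =
        a *: (\sum_(p <- s1) p.2 *m A x p.1).
      by rewrite scaler_sumr; apply: eq_bigr => p _; rewrite scalemxAl.
    by rewrite mxE.
  pose ev g i : config -> k^o := fun x => x g i 0.
  pose x : config := fun g => \col_i L (ev g i).
  pose Lf := HB.pack_for {scalar (config -> k^o)} L (GRing.isLinear.Build _ _ _ _ L Llin).
  have Ax0 : A x = 0.
    apply/funext => g; apply/colP => i; rewrite [RHS]mxE.
    rewrite -(LU (fun x => A x g i 0)); last first.
      exists [:: (g, delta_mx 0 i)] => z.
      by rewrite big_seq1 /= -rowE !mxE.
    have -> : (fun z => A z g i 0) =
        \sum_(t <- D) \sum_j al t i j *: ev (g * t)%g j.
      apply/funext => z; rewrite fct_sumE summxE; apply: eq_bigr => t _.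
      by rewrite fct_sumE mxE; apply: eq_bigr => j' _.
    rewrite -[L]/(Lf : _ -> _) linear_sum summxE; apply: eq_bigr => t _.
    rewrite linear_sum mxE; apply: eq_bigr => j' _.
    by rewrite linearZ mxE.
  have : x 1%g j 0 = 0 by rewrite (Ainj _ Ax0) mxE.
  by rewrite mxE Lj => /eqP; rewrite oner_eq0.
have [s sE] := choice coordU.
have [D' [be BE]] := kop_of_seq (flatten
  [seq [seq (p.1, delta_mx j (0 : 'I_1) *m p.2) | p <- s j] | j <- enum 'I_d]).
exists D', be => x; apply/funext => g; rewrite BE big_flatten big_map big_enum.
apply/colP => i; rewrite summxE (bigD1 i) //= big_map.
have rowE' j : \sum_(p <- s j) delta_mx j (0 : 'I_1) *m p.2 *m A x (g * p.1)%g =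
    x g j 0 *: delta_mx j 0.
  have -> : x g j 0 = (\sum_(p <- s j) p.2 *m A x (g * p.1)%g) 0 0.
    have := sE j (fun u => x (g * u)%g); rewrite mulg1 => ->.
    by congr (fun_of_matrix _ 0 0); apply: eq_bigr => p _; rewrite /A kop_translate.
  transitivity (delta_mx j 0 *m (\sum_(p <- s j) p.2 *m A x (g * p.1)%g)).
    by rewrite mulmx_sumr; apply: eq_bigr => p _; rewrite mulmxA.
  by rewrite [X in _ *m X]mx11_scalar mul_mx_scalar.
rewrite rowE' big1 ?addr0; first by rewrite !mxE !eqxx mulr1.
move=> j /negbTE ji; rewrite big_map rowE' !mxE eq_sym ji mulr0 //.
Qed.

(** The preimages z_j of the basis configurations concentrated at 1 are the columns
of the right inverse.  By translation invariance it inverts A on all finite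
configurations, hence everywhere, as only finitely many places matter at a time. *)
Lemma kop_right_inverse (D : {fset G}) (al : G -> 'M[k]_d) :
  (forall y, asymptotic y 0 -> exists z, asymptotic z 0 /\ kop D (fun=> al) z = y) ->
  exists D' be, cancel (kop D' (fun=> be)) (kop D (fun=> al)).
Proof.
move=> Asurj.
have /choice[z zP] (j : 'I_d) : exists z, asymptotic z 0 /\
    kop D (fun=> al) z = fun g => if g == 1%g then delta_mx j 0 else 0.
  by apply: Asurj; exists [fset 1%g]%fset => g; rewrite in_fset1 => /negbTE ->.
have /choice[E zE] j : exists E : {fset G}, forall g, g \notin E -> z j g = 0.
  by case: (zP j) => -[E zE _]; exists E.
pose D' : {fset G} := [fset g^-1%g | g in \big[fsetU/fset0]_(j < d) E j]%fset.
(* The coefficient at t describes the effect at g of the place g t, whose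
   preimage is z_j translated by g t, hence the inversion. *)
pose be t : 'M[k]_d := \matrix_(i, j) z j t^-1%g i 0.
have be0 t : t \notin D' -> be t = 0.
  move=> tD; apply/matrixP => i j; rewrite !mxE zE ?mxE //.
  apply: contra tD => tE; apply/imfsetP; exists t^-1%g; last by rewrite invgK.
  by apply/bigfcupP; exists j; rewrite ?mem_index_enum.
exists D', be => x; apply/funext => g.
pose K := (1%g |` [fset (t * u)%g | t in D, u in D'])%fset.
rewrite (@kop_comp _ _ _ _ _ K); last first.
  move=> t u tD uD; rewrite in_fsetU; apply/orP; right.
  by apply/imfset2P; exists t => //; exists u.
have coefE h : \sum_(t <- D) \sum_(u <- D' | (t * u)%g == h) al t *m be u =
    (h == 1%g)%:R *: 1%:M.
  transitivity (\sum_(t <- D) al t *m be (t^-1 * h)%g).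
    apply: eq_bigr => t _; rewrite big_mkcond /=.
    have [hD|hD] := boolP ((t^-1 * h)%g \in D').
      rewrite (big_fsetD1 _ hD) /= mulKVg eqxx big1_fset ?addr0 // => u.
      rewrite in_fsetD1 => /andP[uN _] _; case: eqP => // uh.
      by rewrite -uh mulKg eqxx in uN.
    rewrite be0 // mulmx0 big1_fset // => u uD _; case: eqP => // uh.
    by rewrite -uh mulKg uD in hD.
  apply/matrixP => i j; rewrite summxE.
  transitivity (kop D (fun=> al) (z j) h^-1%g i 0).
    rewrite summxE; apply: eq_bigr => t _; rewrite !mxE; apply: eq_bigr => l _.
    by rewrite mxE invMg invgK.
  case: (zP j) => _ ->; rewrite !mxE invg_eq1.
  by case: eqP => _; rewrite !mxE ?mul1r ?mul0r // andbT eq_sym.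
rewrite (big_fsetD1 1%g) ?fset1U1 //= coefE eqxx scale1r mul1mx mulg1.
rewrite big1_fset ?addr0 // => h; rewrite in_fsetD1 coefE => /andP[/negbTE -> _] _.
by rewrite scale0r mul0mx.
Qed.

End OneSidedInverses.

(** * Non-uniform cellular automata *)

Import VectorInternalTheory.

Section NucaKernel.
Variables (k : fieldType) (V : vectType k) (G : groupType) (M : {fset G}).
Local Notation d := (dim V).
Local Notation local := ({ffun M -> V} -> V).

Let coord (v : V) : 'cV[k]_d := (v2r v)^T.
Let uncoord (w : 'cV[k]_d) : V := r2v w^T.
Let coordK : cancel coord uncoord.
Proof. by move=> v; rewrite /coord /uncoord trmxK v2rK. Qed.
Let uncoordK : cancel uncoord coord.
Proof. by move=> w; rewrite /coord /uncoord r2vK trmxK. Qed.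
Let uncoord0 : uncoord 0 = 0.
Proof. by rewrite /uncoord !linear0. Qed.
Let coord0 : coord 0 = 0.
Proof. by rewrite /coord !linear0. Qed.

Lemma nuca_linear (s : G -> local) : (forall g, linear (s g)) -> linear (nuca s).
Proof.
move=> slin a x y; apply/funext => g; rewrite !fctE /nuca -slin; congr (s g _).
by apply/ffunP => m; rewrite !ffunE.
Qed.

Definition linear_nuca (s : G -> local) (slin : forall g, linear (s g)) :=
  HB.pack_for {linear (G -> V) -> (G -> V)} (nuca s)
    (GRing.isLinear.Build _ _ _ _ (nuca s) (nuca_linear slin)).

(** In coordinates, a linear local map is a sum over the memory of matrices applied
to the values, which exhibits the automaton as a matrix operator. *)
Lemma nuca_kop (c : local) : linear c -> exists al : G -> 'M[k]_d, forall x,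
  coord \o nuca (fun=> c) x = kop M (fun=> al) (coord \o x).
Proof.
move=> clin; pose cl := HB.pack_for {linear {ffun M -> V} -> V} c
  (GRing.isLinear.Build _ _ _ _ c clin).
pose single t v : {ffun M -> V} := [ffun m => if val m == t then v else 0].
exists (fun t => \matrix_(i, j) v2r (c (single t (r2v (delta_mx 0 j)))) 0 i) => x.
apply/funext => g; apply/colP => i; rewrite /kop /coord /= mxE summxE.
rewrite big_seq_fsetE /= /nuca.
have -> : restr M (shift g^-1%g x) =
    \sum_(m : M) \sum_(j < d) v2r (x (g * val m)%g) 0 j *:
      single (val m) (r2v (delta_mx 0 j)).
  apply/ffunP => m; rewrite ffunE /shift invgK.
  rewrite sum_ffunE (bigD1 m) //= [X in _ + X]big1 ?addr0 => [|m' m'm]; last first.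
    rewrite sum_ffunE big1 // => j _; rewrite !ffunE.
    by rewrite (inj_eq val_inj) eq_sym (negbTE m'm) scaler0.
  rewrite sum_ffunE; apply: (can_inj v2rK); rewrite linear_sum {1}[v2r _]row_sum_delta.
  by apply: eq_bigr => j _; rewrite !ffunE eqxx linearZ /= r2vK.
rewrite -[c]/(cl : _ -> _) !linear_sum summxE; apply: eq_bigr => m _.
rewrite !linear_sum summxE mxE; apply: eq_bigr => j _.
by rewrite !linearZ !mxE mulrC.
Qed.

Section Sofic.
Variables (R : realType) (sof : sofic R G).
Variables (c : local) (clin : linear c).

Let bijective_of_inverse Da Db al be :
  (forall x, coord \o nuca (fun=> c) x = kop Da (fun=> al) (coord \o x)) ->
  cancel (kop Db (fun=> be)) (kop Da (fun=> al)) \/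
  cancel (kop Da (fun=> al)) (kop Db (fun=> be)) ->
  exists B, cancel (nuca (fun=> c)) B /\ cancel B (nuca (fun=> c)).
Proof.
move=> cE ab.
have [baK abK] : cancel (kop Da (fun=> al)) (kop Db (fun=> be)) /\
    cancel (kop Db (fun=> be)) (kop Da (fun=> al)).
  by case: ab => abK; split=> //; apply: (sofic_direct_finite sof abK).
have co x : uncoord \o (coord \o x) = x :> (G -> V).
  by apply/funext => g /=; rewrite coordK.
exists (fun y => uncoord \o kop Db (fun=> be) (coord \o y)); split=> x.
  by rewrite cE baK co.
rewrite -[LHS]co cE.
rewrite (_ : coord \o _ = kop Db (fun=> be) (coord \o x)) ?abK ?co //.
by apply/funext => g /=; rewrite uncoordK.
Qed.

Lemma injective_ca_bijective : injective (nuca (fun=> c)) ->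
  exists B, cancel (nuca (fun=> c)) B /\ cancel B (nuca (fun=> c)).
Proof.
move=> cinj; have [al alE] := nuca_kop clin.
have [x Ax0|D' [be baK]] := kop_left_inverse (D := M) (al := al).
  have cx0 : nuca (fun=> c) (uncoord \o x) = nuca (fun=> c) 0.
    apply/funext => g; apply: (can_inj coordK).
    rewrite -[LHS]/((coord \o nuca (fun=> c) (uncoord \o x)) g).
    rewrite -[RHS]/((coord \o nuca (fun=> c) 0) g) !alE.
    have -> : coord \o (uncoord \o x) = x.
      by apply/funext => h /=; rewrite uncoordK.
    rewrite Ax0 /kop big1 // => t _; rewrite /= -[(0 : G -> V) _]/(0 : V).
    by rewrite coord0 mulmx0.
  apply/funext => g; apply: (can_inj uncoordK).
  by have := congr1 (fun y => y g) (cinj _ _ cx0); rewrite /= uncoord0.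
by apply: (bijective_of_inverse alE); right; apply: baK.
Qed.

Lemma post_surjective_ca_bijective : post_surjective (nuca (fun=> c)) ->
  exists B, cancel (nuca (fun=> c)) B /\ cancel B (nuca (fun=> c)).
Proof.
move=> csurj; have [al alE] := nuca_kop clin.
have c0 : nuca (fun=> c) 0 = 0 := linear0 (linear_nuca (fun=> clin)).
have [y [E yE]|D' [be abK]] := kop_right_inverse (D := M) (al := al).
  have [|z [[E' zE] zy]] := csurj 0 (uncoord \o y).
    by rewrite c0; exists E => g gE; rewrite /= yE // uncoord0.
  exists (coord \o z); split.
    by exists E' => g gE; rewrite /= zE // coord0.
  by rewrite -alE zy; apply/funext => g /=; rewrite uncoordK.
by apply: (bijective_of_inverse alE); left; apply: abK.
Qed.

End Sofic.
End NucaKernel.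

Lemma mem_orbit_closure (G : groupType) (B : choiceType) (s : G -> B) :
  orbit_closure s s.
Proof.
apply: subset_closure; exists 1%g => //.
by apply/funext => h; rewrite /shift invg1 mul1g.
Qed.

(** Infinity of G provides translations that move the exceptional set of s away
from any finite window, so translates of s converge to the constant. *)
Lemma constant_in_orbit_closure (G : groupType) (B : choiceType) (s : G -> B) c :
  (forall N : {fset G}, exists g, g \notin N) -> asymptotic s (fun=> c) ->
  orbit_closure s (fun=> c).
Proof.
move=> Ginf [E sE].
pose T := {ptws G -> discrete_topology B}.
(* The neighbourhood filter of the constant in the prodiscrete topology. *)
pose F : set_system T := fun A => exists N : {fset G},
  forall f : T, (forall g, g \in N -> f g = c) -> A f.
have FF : Filter F.
  split.
  - by exists fset0.
  - move=> P Q [N1 P1] [N2 P2]; exists (N1 `|` N2)%fset => f fc.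
    by split; [apply: P1|apply: P2] => g gN; apply: fc; rewrite in_fsetU gN ?orbT.
  - by move=> P Q PQ [N PN]; exists N => f /PN /PQ.
have Fc : {ptws, F --> ((fun=> c) : T)}%classic.
  rewrite cvg_sup => i; rewrite cvg_image; last first.
    by rewrite eqEsubset; split=> v // _; exists (cst v).
  move=> W /= /nbhs_singleton Wc; exists (fun f : T => W (f i)).
    by exists [fset i]%fset => f fi; rewrite /= fi ?in_fset1.
  rewrite eqEsubset; split => [j [f ? <-]//|j Wj]; by exists (fun _ => j).
move=> A /Fc [N AN].
have [g gN] := Ginf [fset (h * e^-1)%g | h in N, e in E]%fset.
exists (shift g s); split; first by exists g.
apply: AN => h hN; rewrite /shift; apply: sE; apply: contra gN => hE.
apply/imfset2P; exists h => //; exists (g^-1 * h)%g => //.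
by rewrite invMg invgK mulKVg.
Qed.

Theorem sofic_L1_surjunctive (R : realType) (G : groupType) :
  sofic R G -> L1_surjunctive G.
Proof.
move=> sof k V M s [slin [c [clin sc]]] sinj y.
have Tinj : injective (nuca s) by apply: sinj; apply: mem_orbit_closure.
have [Ginf|] := pselect (forall N : {fset G}, exists g, g \notin N).
  have cinj : injective (nuca (fun=> c)).
    by apply: sinj; apply: constant_in_orbit_closure.
  have [B [CK BK]] := injective_ca_bijective sof clin cinj.
  have [E sE] := sc.
  apply: (finite_modification_surjective (E := E) (T := linear_nuca slin)
    (C := linear_nuca (fun=> clin)) CK BK _ Tinj).
  by move=> x g gE; rewrite /= /nuca sE.
(* G is contained in N, so nuca s is a finite modification of the identity. *)
move=> /existsNP[N /forallNP NG].
apply: (finite_modification_surjective (E := N) (T := linear_nuca slin)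
  (C := idfun) (B := id)) => //.
by move=> x g gN; case: (NG g).
Qed.

(** Since the automaton is linear and fixes 0, post-surjectivity makes it attain
all finite configurations; the Fredholm alternative then gives injectivity on all
configurations, which is stronger than pre-injectivity. *)
Theorem sofic_dual_L1_surjunctive (R : realType) (G : groupType) :
  sofic R G -> dual_L1_surjunctive G.
Proof.
move=> sof k V M s [slin [c [clin sc]]] ssurj.
have Tsurj : post_surjective (nuca s) by apply: ssurj; apply: mem_orbit_closure.
have T0 : nuca s 0 = 0 := linear0 (linear_nuca slin).
have onto (E : {fset G}) y : (forall g, g \notin E -> y g = 0) ->
    exists x, nuca s x = y.
  move=> yE; have [|z [_ zy]] := Tsurj 0 y; last by exists z.
  by rewrite T0; exists E.
suff Tinj : injective (nuca s) by move=> x y _ /Tinj.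
have [Ginf|] := pselect (forall N : {fset G}, exists g, g \notin N).
  have csurj : post_surjective (nuca (fun=> c)).
    by apply: ssurj; apply: constant_in_orbit_closure.
  have [B [CK BK]] := post_surjective_ca_bijective sof clin csurj.
  have [E sE] := sc.
  apply: (finite_modification_injective (E := E) (T := linear_nuca slin)
    (C := linear_nuca (fun=> clin)) CK BK _ (onto E)).
  by move=> x g gE; rewrite /= /nuca sE.
move=> /existsNP[N /forallNP NG].
apply: (finite_modification_injective (E := N) (T := linear_nuca slin)
  (C := idfun) (B := id)) => //.
  by move=> x g gN; case: (NG g).
exact: onto.
Qed.

(** * The twisted group ring *)

Section TwistedGroupRingOperators.
Variables (k : fieldType) (G : groupType).
Local Notation D1 := (D1 k G).
Implicit Types (z w : D1) (b : bool).

(** The coefficients at g of the operator by which z acts: z.1 alone for b false,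
which is the projection to the group ring, and z.1 + z.2(g) for b true.  Treating
both at once is convenient because the two actions together are faithful. *)
Definition D1_eval b (g : G) z : {malg k[G]} := z.1 + z.2@_g *+ b.

Fact D1_eval_is_additive b g : additive (D1_eval b g).
Proof.
by move=> z w; rewrite /D1_eval [(z - w).1]/(z.1 - w.1) [(z - w).2]/(z.2 - w.2)
  mcoeffB mulrnBl opprD addrACA.
Qed.

HB.instance Definition _ b g :=
  GRing.isAdditive.Build _ _ (D1_eval b g) (D1_eval_is_additive b g).

(** The multiplication of the twisted group ring is exactly the composition law for
operators with coefficients z.1 + z.2(g). *)
Lemma D1_evalM b z w g :
  D1_eval b g (z * w) = tconv (D1_eval b g z) (fun t => D1_eval b (g * t)%g w).
Proof.
rewrite /D1_eval; case: b; last first.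
  by rewrite !addr0; apply: eq_tconv => t; rewrite addr0.
rewrite [(z * w).1]/(gmul z.1 w.1) [(z * w).2]/((D1_mul z w).2) D1_mul2E /gmul.
rewrite !mulr1n tconvDl !tconvDr.
by rewrite -!addrA.
Qed.

Lemma D1_eval1 b g : D1_eval b g 1 = << 1%g >>.
Proof. by rewrite /D1_eval [(1 : D1).1]/<< 1%g >> mcoeff0 mul0rn addr0. Qed.

Lemma D1_eval_inj z w : (forall b g, D1_eval b g z = D1_eval b g w) -> z = w.
Proof.
move=> zw; have zw1 : z.1 = w.1.
  by have := zw false 1%g; rewrite /D1_eval !addr0.
apply: D1P => // g; have := zw true g.
by rewrite /D1_eval zw1 => /addrI.
Qed.

Lemma D1_eval_support z : exists D : {fset G},
  forall b g t, t \notin D -> (D1_eval b g z)@_t = 0.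
Proof.
exists (msupp z.1 `|` \big[fsetU/fset0]_(g <- msupp z.2) msupp z.2@_g)%fset.
move=> b g t; rewrite in_fsetU negb_or => /andP[t1 t2].
rewrite /D1_eval mcoeffD mcoeffMn mcoeff_outdom // add0r.
have [gz|/mcoeff_outdom ->] := boolP (g \in msupp z.2); last first.
  by rewrite mcoeff0 mul0rn.
rewrite mcoeff_outdom ?mul0rn //; apply: contra t2 => t2.
by apply/bigfcupP; exists g; rewrite ?gz.
Qed.

Section Matrices.
Variable n : nat.
Implicit Types (X Y : 'M[D1]_n) (D : {fset G}).

Definition D1_kernel b X (g t : G) : 'M[k]_n :=
  \matrix_(i, j) (D1_eval b g (X i j))@_t.

Definition D1_supported D X :=
  forall b i j g t, t \notin D -> (D1_eval b g (X i j))@_t = 0.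

Lemma D1_common_support X Y : exists D, D1_supported D X /\ D1_supported D Y.
Proof.
have supp (Z : 'M[D1]_n) : exists D, D1_supported D Z.
  have /choice[S SP] (p : 'I_n * 'I_n) := D1_eval_support (Z p.1 p.2).
  exists (\big[fsetU/fset0]_p S p)%fset => b i j g t tN.
  apply: (SP (i, j)); apply: contra tN => tS.
  by apply/bigfcupP; exists (i, j); rewrite ?mem_index_enum.
have [[DX XP] [DY YP]] := (supp X, supp Y).
by exists (DX `|` DY)%fset; split=> b i j g t;
  rewrite in_fsetU negb_or => /andP[*]; [apply: XP|apply: YP].
Qed.

Lemma D1_kernelM D X Y b g h : D1_supported D X -> D1_supported D Y ->
  \sum_(t <- D) \sum_(u <- D | (t * u)%g == h)
    D1_kernel b X g t *m D1_kernel b Y (g * t)%g u = D1_kernel b (X *m Y) g h.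
Proof.
move=> XD YD; transitivity (\sum_(t <- D)
    D1_kernel b X g t *m D1_kernel b Y (g * t)%g (t^-1 * h)%g).
  apply: eq_bigr => t _; rewrite big_mkcond /=.
  have [hD|hD] := boolP ((t^-1 * h)%g \in D).
    rewrite (big_fsetD1 _ hD) /= mulKVg eqxx big1_fset ?addr0 // => u.
    rewrite in_fsetD1 => /andP[uN _] _; case: eqP => // uh.
    by rewrite -uh mulKg eqxx in uN.
  rewrite [D1_kernel b Y _ _](_ : _ = 0); last first.
    by apply/matrixP => i j; rewrite !mxE YD.
  rewrite mulmx0 big1_fset // => u uD _; case: eqP => // uh.
  by rewrite -uh mulKg uD in hD.
apply/matrixP => i j; rewrite summxE !mxE.
rewrite (raddf_sum (D1_eval b g)) raddf_sum.
under [RHS]eq_bigr => l _.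
  rewrite /= D1_evalM (@tconvEw _ _ D); first over.
  move=> t; rewrite -mcoeff_neq0; apply: contraNT => tD; exact/eqP/XD.
rewrite exchange_big /=; apply: eq_bigr => t _; rewrite mxE.
by apply: eq_bigr => l _; rewrite !mxE.
Qed.

Lemma D1_kernel1 b g h : D1_kernel b 1%:M g h = (h == 1%g)%:R *: 1%:M.
Proof.
apply/matrixP => i j; rewrite !mxE; have [_|_] := eqVneq i j.
  by rewrite mulr1 [(1 *+ true : D1)]mulr1n D1_eval1 mcoeffU eq_sym.
by rewrite mulr0n (raddf0 (D1_eval b g)) mcoeff0 mulr0.
Qed.

(** The set S allows the summation range K to be enlarged by the places of
interest. *)
Lemma kop_D1_comp D X Y b x g (S : {fset G}) :
  D1_supported D X -> D1_supported D Y ->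
  exists K : {fset G}, {subset S <= K} /\
  kop D (D1_kernel b X) (kop D (D1_kernel b Y) x) g =
    \sum_(h <- K) D1_kernel b (X *m Y) g h *m x (g * h)%g.
Proof.
move=> XD YD; exists (S `|` [fset (t * u)%g | t in D, u in D])%fset; split.
  by move=> s sS; rewrite in_fsetU sS.
rewrite (kop_comp (K := (S `|` [fset (t * u)%g | t in D, u in D])%fset)).
  by apply: eq_bigr => h _; rewrite D1_kernelM.
move=> t u tD uD; rewrite in_fsetU; apply/orP; right.
by apply/imfset2P; exists t => //; exists u.
Qed.

(** Being inverse to each other can be tested on the two actions: apply the
operators to the configurations concentrated at one place to recover the
coefficients. *)
Lemma D1_mul_eq1P D X Y : D1_supported D X -> D1_supported D Y ->
  X *m Y = 1%:M <->
  forall b, cancel (kop D (D1_kernel b Y)) (kop D (D1_kernel b X)).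
Proof.
move=> XD YD; split=> [XY1 b x|XYK].
  apply/funext => g; have [K [K1 ->]] := kop_D1_comp b x g [fset 1%g]%fset XD YD.
  rewrite XY1 (big_fsetD1 1%g) ?K1 ?in_fset1 //= D1_kernel1 eqxx scale1r mul1mx mulg1.
  rewrite big1_fset ?addr0 // => h; rewrite in_fsetD1 D1_kernel1 => /andP[/negbTE -> _] _.
  by rewrite scale0r mul0mx.
apply/matrixP => i j; apply: D1_eval_inj => b g; apply/malgP => h.
suff : D1_kernel b (X *m Y) g h = D1_kernel b 1%:M g h.
  by move/matrixP/(_ i j); rewrite !mxE.
rewrite D1_kernel1; apply/matrixP => {}i {}j.
pose x u : 'cV[k]_n := if u == (g * h)%g then delta_mx j 0 else 0.
have [K [Kh]] := kop_D1_comp b x g [fset h]%fset XD YD.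
rewrite XYK (big_fsetD1 h) ?Kh ?in_fset1 //= big1_fset ?addr0; last first.
  move=> h'; rewrite in_fsetD1 /x (inj_eq (mulgI g)) => /andP[/negbTE -> _] _.
  by rewrite mulmx0.
rewrite {2}/x eqxx -colE => /colP/(_ i); rewrite [in RHS]mxE => <-.
rewrite /x -{1}[g]mulg1 (inj_eq (mulgI g)) eq_sym !mxE.
by case: eqP => _; rewrite !mxE ?mul1r ?mul0r // andbT.
Qed.

End Matrices.
End TwistedGroupRingOperators.

Theorem sofic_D1_stably_finite (R : realType) (G : groupType) (k : fieldType) :
  sofic R G -> stably_finite (D1 k G).
Proof.
move=> sof n A _.
have comm (X Y : 'M[D1 k G]_n) : X *m Y = 1%:M -> Y *m X = 1%:M.
  move=> XY1; have [D [XD YD]] := D1_common_support X Y.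
  have XYK := (D1_mul_eq1P XD YD).1 XY1.
  have CK : cancel (kop D (D1_kernel false X)) (kop D (D1_kernel false Y)).
    have uniform (Z : 'M[D1 k G]_n) :
        D1_kernel false Z = fun=> D1_kernel false Z 1%g.
      apply/funext => g; apply/funext => t; apply/matrixP => i j.
      by rewrite !mxE /D1_eval !mulr0n.
    have := XYK false; rewrite (uniform X) (uniform Y).
    exact: sofic_direct_finite sof.
  have TK : cancel (kop D (D1_kernel true X)) (kop D (D1_kernel true Y)).
    pose E : {fset G} := \big[fsetU/fset0]_(p : 'I_n * 'I_n) msupp (X p.1 p.2).2.
    have Tinj : injective (kop D (D1_kernel true X)).
      apply: (finite_modification_injective (E := E)
        (T := kop D (D1_kernel true X))
        (C := kop D (D1_kernel false X)) CK (XYK false)).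
      - move=> x g gE; apply: eq_bigr => t _; congr (_ *m _).
        apply/matrixP => i j; rewrite !mxE /D1_eval mulr1n mulr0n.
        rewrite (@mcoeff_outdom _ _ (X i j).2 g) //.
        by apply: contra gE => gX; apply/bigfcupP; exists (i, j); rewrite ?mem_index_enum.
      - by move=> y _; exists (kop D (D1_kernel true Y) y); apply: XYK.
    by move=> x; apply: Tinj; rewrite XYK.
  by apply/(D1_mul_eq1P YD XD) => -[].
by case=> -[B AB]; exists B; split=> //; apply: comm.
Qed.

Theorem theoremF (R : realType) (G : groupType)
    (G_fg : finitely_generated G) (G_sofic : sofic R G) :
  L1_surjunctive G /\
  dual_L1_surjunctive G /\
  (forall k : fieldType, stably_finite (D1 k G)).
Proof.
split; first exact: sofic_L1_surjunctive G_sofic.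
split; first exact: sofic_dual_L1_surjunctive G_sofic.
by move=> k; apply: sofic_D1_stably_finite G_sofic.
Qed.
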